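(* Let $L$ be a loop which is diassociative and which is an A-loop. Then $L$ is a Moufang loop, i.e. $x(y\cdot xz)=(xy\cdot x)z$ for all $x,y,z\in L$.
   Context: A loop $(L,\cdot)$ is a nonempty set $L$ with a binary operation $\cdot$ (usually written as juxtaposition) such that (i) for all $a,b\in L$ the equations $ax=b$ and $ya=b$ each have unique solutions $x,y\in L$, and (ii) there is an identity element $1\in L$ with $1x=x1=x$ for all $x\in L$. Juxtaposition binds more tightly than $\cdot$, so $x(y\cdot xz)$ means $x(y(xz))$ and $(xy\cdot x)z$ means $((xy)x)z$. For $x\in L$ the left and right translations are the permutations of $L$ defined (maps written on the right) by $yL(x)=xy$ and $yR(x)=yx$. The multiplication group $\mathrm{Mlt}(L)$ is the permutation group on $L$ generated by all $L(x),R(x)$, $x\in L$. The inner mapping group $\mathrm{Mlt}_1(L)$ is the subgroup of $\mathrm{Mlt}(L)$ fixing $1$; its elements are the inner mappings. An A-loop is a loop in which every inner mapping is an automorphism of $L$. A loop $L$ is diassociative if for all $x,y\in L$ the subloop $\langle x,y\rangle$ generated by $x,y$ is a group. *)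

(* Defs.v *)
From HB Require Import structures.
From mathcomp Require Import ssreflect ssrfun ssrbool monoid.
From mathcomp Require Import classical_sets.

Set Implicit Arguments.
Unset Strict Implicit.
Unset Printing Implicit Defensive.

Local Open Scope group_scope.
Local Open Scope classical_set_scope.

(* The carrier is an arbitrary type: it is neither finite nor a choiceType, so
   this structure lies above baseUMagmaType but not above umagmaType. *)
HB.mixin Record BaseUMagma_isLoop L of BaseUMagma L := {
  loop_mul1g : left_id 1 (@mul L);
  loop_mulg1 : right_id 1 (@mul L);
  loop_ldiv : forall a b : L, exists! x : L, a * x = b;
  loop_rdiv : forall a b : L, exists! y : L, y * a = b
}.

#[short(type="loopType")]
HB.structure Definition Loop := {L of BaseUMagma_isLoop L & BaseUMagma L}.

Bind Scope group_scope with Loop.sort.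

Section LoopDefs.
Variable L : loopType.
Implicit Types (x y z a b : L) (S : set L) (f g : L -> L).

Definition left_translation x : L -> L := fun y => x * y.
Definition right_translation x : L -> L := fun y => y * x.

(* Permutations are represented by bijective functions; the inverse of f is
   described as any two-sided inverse function. *)
Record permutation_group (G : set (L -> L)) : Prop := PermutationGroup {
  permutation_group_bij : forall f, G f -> bijective f;
  permutation_group1 : G id;
  permutation_groupM : forall f g, G f -> G g -> G (f \o g);
  permutation_groupV : forall f g, G f -> cancel f g -> cancel g f -> G g
}.

Definition Mlt : set (L -> L) :=
  smallest permutation_group (range left_translation `|` range right_translation).

Definition inner_mappings : set (L -> L) := [set f | Mlt f /\ f 1 = 1].

Definition loop_automorphism f : Prop :=
  bijective f /\ {morph f : x y / x * y}.

Definition A_loop : Prop :=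
  forall f, inner_mappings f -> loop_automorphism f.

(* A subset that is a loop under the restricted operation; its solutions of
   a x = b and y a = b are those of the ambient loop, by uniqueness there. *)
Record subloop S : Prop := Subloop {
  subloop1 : S 1;
  subloopM : forall a b, S a -> S b -> S (a * b);
  subloop_ldiv : forall a b x, S a -> S b -> a * x = b -> S x;
  subloop_rdiv : forall a b y, S a -> S b -> y * a = b -> S y
}.

Definition generated_subloop x y : set L := smallest subloop [set x; y].

Definition group_on S : Prop :=
  [/\ forall a b, S a -> S b -> S (a * b),
      forall a b c, S a -> S b -> S c -> a * (b * c) = (a * b) * c &
      exists2 e, S e &
        (forall a, S a -> e * a = a /\ a * e = a) /\
        (forall a, S a -> exists2 b, S b & a * b = e /\ b * a = e)].

Definition diassociative : Prop :=
  forall x y, group_on (generated_subloop x y).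

Definition moufang : Prop :=
  forall x y z, x * (y * (x * z)) = ((x * y) * x) * z.

End LoopDefs.

Arguments Mlt : clear implicits.
Arguments inner_mappings : clear implicits.
Arguments A_loop : clear implicits.
Arguments diassociative : clear implicits.
Arguments moufang : clear implicits.

(* Main.v *)
Require Import Defs.
From mathcomp Require Import ssreflect ssrfun ssrbool monoid.
From mathcomp Require Import boolp classical_sets.

Set Implicit Arguments.
Unset Strict Implicit.
Unset Printing Implicit Defensive.

Local Open Scope group_scope.
Local Open Scope classical_set_scope.

(* Only the inverse property, flexibility and both alternative laws are used
   from diassociativity.  With operators acting on the right, associators are
   measured by the inner mappings
     f(a,x) = L(ax) L(a)^-1 L(x)^-1,    c(a,y) = L(a) R(y) L(a)^-1 R(y)^-1,
   that is, (ax)y = a(x . y f(a,x)) = a(x c(a,y) . y); below, y f(a,x) is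
   lassoc a x y and x c(a,y) is massoc a y x.  Being automorphisms, they
   satisfy x f(a,y) = x c(a, y^-1 x).  As c(a,ay) = c(a,ya) = c(a,y), replacing
   x by xa here, and by ax in the mirror image of this identity, shows that
   x c(a,y) is fixed by f(x,a) and f(a,x), hence by their quotient c(a,x).
   From x . y f(a,x) = x c(a,y) . y one then gets f(a^-1,x) = f(a,x)^-1, which
   is a form of the Moufang law. *)

Section Loops.
Variable L : loopType.
Implicit Types (a x y z : L) (f g : L -> L).

Lemma ldivI x y z : x * y = x * z -> y = z.
Proof.
move=> e; have [w [_ uw]] := loop_ldiv x (x * z).
by rewrite -(uw y e) -(uw z erefl).
Qed.

Lemma rdivI x y z : y * x = z * x -> y = z.
Proof.
move=> e; have [w [_ uw]] := loop_rdiv x (z * x).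
by rewrite -(uw y e) -(uw z erefl).
Qed.

Lemma has_rinv x : exists y, x * y = 1.
Proof. by have [y [? _]] := loop_ldiv x 1; exists y. Qed.

Definition linv x : L := projT1 (cid (has_rinv x)).
Local Notation "x ^-1" := (linv x) : group_scope.

Lemma mulxV x : x * x^-1 = 1.
Proof. exact: projT2 (cid (has_rinv x)). Qed.

Lemma subloop_generated x y : subloop (generated_subloop x y).
Proof.
split=> [S [[]]//|a b Sa Sb S SP|a b z Sa Sb e S SP|a b z Sa Sb e S SP].
- by have [SS _] := SP; apply: (subloopM SS); [apply: Sa|apply: Sb].
- by have [SS _] := SP; apply: (subloop_ldiv SS _ _ e); [apply: Sa|apply: Sb].
- by have [SS _] := SP; apply: (subloop_rdiv SS _ _ e); [apply: Sa|apply: Sb].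
Qed.

(** * Inverse property, flexibility and alternative laws *)

Section Diassociative.
Hypothesis diL : diassociative L.

Lemma di_assoc x y a b c :
    generated_subloop x y a -> generated_subloop x y b ->
  generated_subloop x y c -> a * (b * c) = (a * b) * c.
Proof. by have [_ + _] := diL x y; apply. Qed.

Lemma gen_l x y : generated_subloop x y x.
Proof. by move=> S [_]; apply; left. Qed.

Lemma gen_r x y : generated_subloop x y y.
Proof. by move=> S [_]; apply; right. Qed.

Lemma gen_lV x y : generated_subloop x y x^-1.
Proof.
have SS := subloop_generated x y.
by apply: (subloop_ldiv SS _ _ (mulxV x)); [apply: gen_l|apply: subloop1].
Qed.

Hint Resolve gen_l gen_r gen_lV : core.

Lemma mulxxA x y : x * (x * y) = (x * x) * y.
Proof. exact: (@di_assoc x y). Qed.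

Lemma mulxyyA x y : x * (y * y) = (x * y) * y.
Proof. exact: (@di_assoc x y). Qed.

Lemma mulxyxA x y : x * (y * x) = (x * y) * x.
Proof. exact: (@di_assoc x y). Qed.

Lemma mulKVx x y : x * (x^-1 * y) = y.
Proof. by rewrite (@di_assoc x y) // mulxV loop_mul1g. Qed.

Lemma mulKx x y : x^-1 * (x * y) = y.
Proof. by apply: (@ldivI x); rewrite mulKVx. Qed.

Lemma mulVx x : x^-1 * x = 1.
Proof. by rewrite -{2}(loop_mulg1 x) mulKx. Qed.

Lemma mulxK x y : (y * x) * x^-1 = y.
Proof. by rewrite -(@di_assoc x y) // mulxV loop_mulg1. Qed.

Lemma mulxKV x y : (y * x^-1) * x = y.
Proof. by rewrite -(@di_assoc x y) // mulVx loop_mulg1. Qed.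

Lemma linvK x : x^-1^-1 = x.
Proof. by apply: (@ldivI x^-1); rewrite mulxV mulVx. Qed.

Lemma linvM x y : (x * y)^-1 = y^-1 * x^-1.
Proof. by apply: (@rdivI x); rewrite mulxKV -{2}(mulxK y x) mulKx. Qed.

(** * Inner mappings as automorphisms *)

Section Automorphic.
Hypothesis autL : A_loop L.

Lemma Mlt_mull x : Mlt L (fun y => x * y).
Proof. by move=> G [_]; apply; left; exists x. Qed.

Lemma Mlt_mulr x : Mlt L (fun y => y * x).
Proof. by move=> G [_]; apply; right; exists x. Qed.

Lemma Mlt_comp f g : Mlt L f -> Mlt L g -> Mlt L (fun y => f (g y)).
Proof.
move=> Gf Gg G GG; case: (GG) => PG _.
by apply: (permutation_groupM PG); [apply: Gf|apply: Gg].
Qed.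

Section Automorphism.
Variable h : L -> L.
Hypothesis aut_h : loop_automorphism h.

Lemma autM : {morph h : x y / x * y}. Proof. by case: aut_h. Qed.

Lemma aut_inj : injective h. Proof. by case: aut_h => /bij_inj. Qed.

Lemma autV : {morph h : x / x^-1}.
Proof.
have h1 : h 1 = 1 by apply: (@ldivI (h 1)); rewrite -autM !loop_mulg1.
by move=> x; apply: (@ldivI (h x)); rewrite -autM !mulxV.
Qed.
End Automorphism.

(** * The associator maps and their first identities *)

Definition lassoc a x y := x^-1 * (a^-1 * ((a * x) * y)).
Definition massoc a y x := (a^-1 * ((a * x) * y)) * y^-1.

Lemma lassocP a x y : (a * x) * y = a * (x * lassoc a x y).
Proof. by rewrite /lassoc !mulKVx. Qed.

Lemma massocP a y x : (a * x) * y = a * (massoc a y x * y).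
Proof. by rewrite /massoc mulxKV mulKVx. Qed.

Lemma lassoc_aut a x : loop_automorphism (lassoc a x).
Proof.
apply: autL; split; last by rewrite /lassoc loop_mulg1 mulKx mulVx.
by do 2! (apply: Mlt_comp; first exact: Mlt_mull); exact: Mlt_mull.
Qed.

Lemma massoc_aut a y : loop_automorphism (massoc a y).
Proof.
apply: autL; split; last by rewrite /massoc loop_mulg1 mulKx mulxV.
apply: (Mlt_comp (Mlt_mulr _)); apply: (Mlt_comp (Mlt_mull _)).
by apply: (Mlt_comp (Mlt_mulr _)); apply: Mlt_mull.
Qed.

Lemma conj_aut a : loop_automorphism (fun x => a^-1 * (x * a)).
Proof.
apply: autL; split; last by rewrite loop_mul1g mulVx.
by apply: (Mlt_comp (Mlt_mull _)); apply: Mlt_mulr.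
Qed.

Definition lassocM a x := autM (lassoc_aut a x).
Definition massocM a y := autM (massoc_aut a y).
Definition lassocV a x := autV (lassoc_aut a x).
Definition massocV a y := autV (massoc_aut a y).

Lemma aut_lassoc h a x y : loop_automorphism h ->
  h (lassoc a x y) = lassoc (h a) (h x) (h y).
Proof. by move=> hA; rewrite /lassoc !(autM hA) !(autV hA). Qed.

Lemma aut_massoc h a y x : loop_automorphism h ->
  h (massoc a y x) = massoc (h a) (h y) (h x).
Proof. by move=> hA; rewrite /massoc !(autM hA) !(autV hA). Qed.

Lemma lassoc_fixl a x : lassoc a x a = a.
Proof. by rewrite /lassoc -mulxyxA !mulKx. Qed.

Lemma lassoc_fixr a x : lassoc a x x = x.
Proof. by rewrite /lassoc -mulxyyA !mulKx. Qed.

Lemma massoc_fixl a y : massoc a y a = a.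
Proof. by rewrite /massoc -mulxxA mulKx mulxK. Qed.

Lemma massoc_fixr a y : massoc a y y = y.
Proof. by rewrite /massoc -mulxyyA mulKx mulxK. Qed.

Lemma lassoc_massoc a x y : x * lassoc a x y = massoc a y x * y.
Proof. by apply: (@ldivI a); rewrite -lassocP massocP. Qed.

(** With [y = x * t], the maps [lassoc a x] and [massoc a t] fix [x] and [t] respectively, so the
    claim becomes [lassoc_massoc]. *)
Lemma lassocE a x y : lassoc a x y = massoc a (x^-1 * y) y.
Proof.
rewrite -{1 3}(mulKVx x y); set t := x^-1 * y.
by rewrite lassocM massocM lassoc_fixr massoc_fixr lassoc_massoc.
Qed.

Lemma massocE a x y : massoc a y x = lassoc a (x * y^-1) x.
Proof. by rewrite lassocE linvM linvK mulxKV. Qed.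

(* The automorphism R(x) R(a) R(xa)^-1 commutes with inversion, which turns it
   into L(x)^-1 L(a)^-1 L(xa); as it fixes xa, the factors may be rotated. *)
Lemma rassocP a x z : (z * x) * a = lassoc x a z * (x * a).
Proof.
pose r z := ((z * x) * a) * (x * a)^-1.
have rA : loop_automorphism r.
  apply: autL; split; last by rewrite /r loop_mul1g mulxV.
  apply: (Mlt_comp (Mlt_mulr _)); apply: (Mlt_comp (Mlt_mulr _)).
  exact: Mlt_mulr.
have rxa : r (x * a) = x * a.
  by rewrite (autM rA); congr (_ * _); rewrite /r -(mulxxA, mulxyxA) mulxK.
have rE t : r t = (x * a) * (a^-1 * (x^-1 * t)).
  by rewrite -{1}(linvK t) (autV rA) /r !linvM !linvK.
suff -> : lassoc x a z = r z by rewrite /r mulxKV.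
by apply: (@ldivI (x * a)); rewrite -{2}rxa -(autM rA) rE.
Qed.

(* c(a,x) = c(a^-1,x^-1), in the guise obtained by inverting arguments. *)
Lemma rmassocP a x y : (x * massoc a x y) * a = x * (y * a).
Proof.
have E t : t * a^-1 = x * ((x^-1 * massoc a x t) * a^-1).
  have := congr1 linv (massocP a x t^-1).
  rewrite massocV !linvM !linvK => <-.
  by rewrite mulKVx.
by rewrite -[RHS](mulxKV a) E !massocM massoc_fixl massoc_fixr mulKx mulxK.
Qed.

(** The mirror image of [lassocE]: by [rassocP] and [rmassocP], passing to the opposite loop turns
    [lassoc a y] into the inverse of [lassoc y a] and keeps [massoc a x]. *)
Lemma lassoc_massocK a x y : lassoc y a (massoc a (x * y^-1) x) = x.
Proof.
have E t : lassoc y a (massoc a t (t * y)) = t * y.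
  rewrite massocM massoc_fixr lassocM aut_massoc; last exact: lassoc_aut.
  rewrite lassoc_fixl lassoc_fixr.
  by apply: (@rdivI a); rewrite rmassocP rassocP.
by rewrite -{2}(mulxKV y x) E mulxKV.
Qed.

(** * Invariances and fixed points *)

Lemma massoc_mulr a x y : massoc a (y * a) x = massoc a y x.
Proof.
(* Fixing [y] and [a], [lassoc y a] commutes with [massoc a (y * a)]. *)
apply: (aut_inj (lassoc_aut y a)); rewrite aut_massoc; last exact: lassoc_aut.
rewrite lassocM lassoc_fixl lassoc_fixr.
apply: (@rdivI (y * a)); apply: (@ldivI a).
(* Both sides equal [((a * x) * y) * a]. *)
have -> : a * (lassoc y a (massoc a y x) * (y * a)) = (lassoc y a (a * x)) * (y * a).
  by rewrite -!rassocP (massocP a y x) mulxyxA.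
by rewrite -massocP lassocM lassoc_fixr.
Qed.

Lemma massoc_mull a x y : massoc a (a * y) x = massoc a y x.
Proof.
apply: (aut_inj (lassoc_aut a y)); rewrite aut_massoc; last exact: lassoc_aut.
rewrite lassocM lassoc_fixl lassoc_fixr.
apply: (@rdivI (a * y)); apply: (@ldivI a).
(* Both sides equal [((a * x) * a) * y]. *)
have -> : a * (lassoc a y (massoc a y x) * (a * y)) = (lassoc a y (a * x)) * (a * y).
  by rewrite -!rassocP -mulxyxA (massocP a y (x * a)) massocM massoc_fixl.
by rewrite -massocP lassocM lassoc_fixl.
Qed.

(* In x f(a,z) = x c(a, z^-1 x), replace x by xa. *)
Lemma lassoc_fix_massoc_r a x y : lassoc x a (massoc a y x) = massoc a y x.
Proof.
rewrite massocE; set z := x * y^-1.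
have E : lassoc a z x = massoc a (z^-1 * (x * a)) x.
  apply: (@rdivI a).
  by rewrite -{2}(lassoc_fixl a z) -lassocM lassocE massocM massoc_fixl.
rewrite {1}E aut_massoc; last exact: lassoc_aut.
have -> : lassoc x a (z^-1 * (x * a)) = (z^-1 * x) * a.
  by rewrite rassocP lassocM lassocM lassoc_fixl lassoc_fixr.
by rewrite lassoc_fixl lassoc_fixr massoc_mulr -lassocE.
Qed.

(* Replace x by ax in lassoc_massocK. *)
Lemma lassoc_fix_massoc_l a x y : lassoc a x (massoc a y x) = massoc a y x.
Proof.
rewrite aut_massoc; last exact: lassoc_aut.
rewrite lassoc_fixl lassoc_fixr.
pose z := (x^-1 * y)^-1; apply: (aut_inj (lassoc_aut z a)).
have xz : x * z^-1 = y by rewrite linvK mulKVx.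
have e : (a * x) * z^-1 = a * lassoc a x y.
  by rewrite lassocP -{1}(lassoc_fixr a x) -lassocM xz.
have := lassoc_massocK a (a * x) z.
rewrite e massoc_mull massocM massoc_fixl lassocM lassoc_fixr => /ldivI ->.
by rewrite -{1}xz lassoc_massocK.
Qed.

(* f(x,a) = f(a,x) c(a,x)^-1, by invariance of f(a,x) under conjugation by a. *)
Lemma massoc_lassoc a x z : massoc a x (lassoc x a z) = lassoc a x z.
Proof.
pose T t := a^-1 * (t * a); have TA : loop_automorphism T := conj_aut a.
have aT t : a * T t = t * a by rewrite mulKVx.
have TT t : T ((a * t) * a^-1) = t by rewrite /T mulxKV mulKx.
have T_lassoc t : lassoc a x (T t) = T (lassoc a x t).
  by rewrite /T !(lassocM, lassocV) lassoc_fixl.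
have lassoc_T t : lassoc a (T x) (T t) = T (lassoc a x t).
  by rewrite (aut_lassoc _ _ _ TA) /T mulKx.
have e : lassoc a (T x) z = lassoc a x z.
  by rewrite -(TT z) lassoc_T T_lassoc.
have E : x * (a * lassoc x a z) = (x * ((a * lassoc a x z) * a^-1)) * a.
  by rewrite -lassocP -!aT (autM TA) TT lassocP e.
move: E; rewrite -(mulxKV a (a * lassoc x a z)) -rmassocP => /rdivI/ldivI.
by rewrite !massocM massocV massoc_fixl => /rdivI/ldivI.
Qed.

Lemma massoc_fix_massoc a x y : massoc a x (massoc a y x) = massoc a y x.
Proof.
by rewrite -{1}(lassoc_fix_massoc_r a x y) massoc_lassoc lassoc_fix_massoc_l.
Qed.

Lemma massoc_fix_lassoc a x y : massoc a y (lassoc a x y) = lassoc a x y.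
Proof. by rewrite lassocE massoc_fix_massoc. Qed.

(** * Effect of inverting arguments, and the Moufang law *)

Lemma massocVlP a x y : (a * massoc a^-1 y x) * y = a * (x * y).
Proof.
have := massocP a^-1 y (a * x); rewrite mulKx massocM => ->.
have -> : massoc a^-1 y a = a by rewrite -{2}(linvK a) massocV massoc_fixl linvK.
by rewrite mulKVx.
Qed.

Lemma massocK a y : cancel (massoc a y) (massoc a^-1 y).
Proof.
by move=> x; apply: (@ldivI a); apply: (@rdivI y); rewrite massocVlP -massocP.
Qed.

Lemma massocVr a x y : massoc a y^-1 x = massoc a^-1 y x.
Proof.
apply: (@ldivI a); apply: (@rdivI y); rewrite massocVlP.
have fix_y : massoc a y^-1 y = y.
  by rewrite -{2}(linvK y) massocV massoc_fixr linvK.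
have := massocP a y^-1 (x * y); rewrite massocM fix_y mulxK => <-.
by rewrite mulxKV.
Qed.

Lemma lassocVK a x y : lassoc a x (lassoc a^-1 x y) = y.
Proof.
apply: (@ldivI x); apply: (aut_inj (massoc_aut a y)).
(* Here [x * lassoc a^-1 x y] is [massoc a^-1 y x * y], whose first factor, being [massoc a y^-1 x],
   is fixed by [lassoc a x]. *)
rewrite -{1}(lassoc_fixr a x) -lassocM lassoc_massoc -massocVr.
rewrite lassocM lassoc_fix_massoc_l massocVr massocM massoc_fix_lassoc.
(* Now [massoc a y] sends [massoc a^-1 y x] back to [x], and both sides reduce to those of
   [lassoc_massoc]. *)
rewrite -{1}(linvK a) massocK.
by rewrite massocM massoc_fixr lassoc_massoc.
Qed.

(** Inverting [lassocP] at [y^-1], [x^-1] reverses the reassociation of [rassocP]. *)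
Lemma lassocVV x y z : lassoc y^-1 x^-1 (lassoc x y z) = z.
Proof.
apply: (@rdivI x); apply: (@rdivI y); rewrite (rassocP y x z).
move: (lassoc x y z) => t.
have := congr1 linv (lassocP y^-1 x^-1 t^-1).
by rewrite lassocV; move: (lassoc _ _ t) => s; rewrite !linvM !linvK.
Qed.

Lemma lassoc_swapV x y z : lassoc y x^-1 z = lassoc x y z.
Proof. by rewrite -{1}(lassocVV x y z) lassocVK. Qed.

Lemma lassocKM x y z : lassoc x y (lassoc x^-1 (x * y) z) = z.
Proof.
apply: (@ldivI y); apply: (@ldivI x); rewrite -lassocP.
by have := lassocP x^-1 (x * y) z; rewrite mulKx => ->; rewrite mulKVx.
Qed.

Lemma diassociative_A_loop_moufang : moufang L.
Proof.
move=> x y z; rewrite !lassocP.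
(* Two swaps bring in [lassoc x^-1 (x * y)], which [lassoc x y] undoes by [lassocKM]. *)
have -> t : lassoc (x * y) x t = lassoc x^-1 (x * y) t.
  by rewrite -{2}(linvK (x * y)) !lassoc_swapV.
by rewrite lassocM lassoc_fixl lassocKM.
Qed.
End Automorphic.
End Diassociative.
End Loops.

Theorem theorem1 (L : loopType) : diassociative L -> A_loop L -> moufang L.
Proof. exact: diassociative_A_loop_moufang. Qed.
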